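(* Let $A$ be an alphabet of size $n\ge 2$, let $k\ge 1$ and let $T\subseteq [1,k]$ be a subset of ranks. The $S_n$-module induced by the action of $S_n$ on the maximal chains of the rank-selected subposet of $A^*$ of words with lengths in $T$ is a nonnegative integer combination of tensor powers $S_{(n-1,1)}^{\otimes i}$ ($i\ge 0$) of the reflection representation $S_{(n-1,1)}$. If $|T|\ge 1$, the Frobenius characteristic of this module is $h$-positive and supported on the set $T_1(n)=\{h_\lambda : \lambda=(n-r,1^r),\ r\ge 1\}$; that is, it is a nonnegative integer combination of the symmetric functions in $T_1(n)$.
   Context: $A^*$ is the set of all finite words in the alphabet $A$, $|A|=n$, including the empty word, ordered by the subword order: $u\le v$ if $u$ is obtained from $v$ by deleting letters (not necessarily consecutive). The rank of a word is its length, and $[1,k]=\{1,\dots,k\}$. $S_n$ acts on $A$ by permuting letters, hence on words and on chains of words. A maximal chain of the rank-selected subposet for $T=\{s_1<\dots<s_p\}$ is a chain $w_1<\dots<w_p$ with $|w_i|=s_i$; for $T=\emptyset$ the only maximal chain is the empty chain, giving the trivial module. All representations are over $\mathbb{C}$. $S_\lambda$ is the irreducible $S_n$-module indexed by the partition $\lambda$ of $n$; the $0$th tensor power is the trivial module $S_{(n)}$. The Frobenius characteristic $\mathrm{ch}$ sends an $S_n$-module to a symmetric function of degree $n$. $h_m$ is the complete homogeneous symmetric function, $h_0=1$, and $h_\lambda$ for $\lambda=(n-r,1^r)$ means $h_1^r h_{n-r}$, where $r\le n$. *)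

(* Defs.v *)
From HB Require Import structures.
From mathcomp Require Export all_boot all_order all_algebra all_fingroup.
From mathcomp Require Export mxrepresentation character.
From mathcomp Require Export reals.
From mathcomp Require Export complex mpoly.

Set Implicit Arguments.
Unset Strict Implicit.
Unset Printing Implicit Defensive.

Import GRing.Theory.
Local Open Scope ring_scope.

Section PermutationModule.

Variables (F : fieldType) (aT : finGroupType) (X : finType).
Variable to : {action aT &-> X}.

(* Modules are spaces of row vectors acted on from the right, so basis vector
   number i (the point enum_val i) times this matrix is the basis vector of the
   point "to (enum_val i) g". *)
Definition perm_repr_mx (g : aT) : 'M[F]_#|X| :=
  \matrix_(i, j) (to (enum_val i) g == enum_val j)%:R.

Lemma perm_repr_mxP : mx_repr [set: aT] perm_repr_mx.
Proof.
split=> [|g h _ _]; apply/matrixP=> i j; rewrite !mxE.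
  by rewrite act1 (inj_eq enum_val_inj).
rewrite (bigD1 (enum_rank (to (enum_val i) g))) //= !mxE enum_rankK eqxx mul1r.
rewrite actM big1 ?addr0 // => l neq; rewrite !mxE.
case: eqP => [e|]; last by rewrite mul0r.
by case/eqP: neq; rewrite e enum_valK.
Qed.

Definition perm_repr : mx_representation F [set: aT] #|X| :=
  MxRepresentation perm_repr_mxP.

End PermutationModule.

Section ReflectionRepresentation.

Variables (F : fieldType) (n : nat).

Definition natural_repr : mx_representation F [set: 'S_n] #|'I_n| :=
  perm_repr F ('P)%act.

(* The hyperplane of vectors whose coordinates sum to 0 in the natural
   permutation module F^n; over a field of characteristic 0 it is the
   irreducible (Specht) module of the partition (n - 1, 1). *)
Definition sum_zero : 'M[F]_#|'I_n| :=
  kermx (const_mx 1 : 'M[F]_(#|'I_n|, 1)).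

Lemma sum_zero_module : mxmodule natural_repr sum_zero.
Proof.
apply/mxmoduleP=> g _; apply/sub_kermxP; rewrite -mulmxA.
suff -> : natural_repr g *m const_mx 1 = const_mx 1 :> 'M[F]_(_, 1).
  exact: mulmx_ker.
apply/matrixP=> i j; rewrite !mxE.
rewrite (bigD1 (enum_rank (aperm (enum_val i) g))) //= !mxE enum_rankK eqxx.
rewrite mul1r big1 ?addr0 // => l neq; rewrite !mxE mulr1.
by case: eqP => // e; case/eqP: neq; rewrite e enum_valK.
Qed.

Definition refl_repr : mx_representation F [set: 'S_n] (\rank sum_zero) :=
  submod_repr sum_zero_module.

End ReflectionRepresentation.

Section TensorPower.

Variables (F : fieldType) (gT : finGroupType) (G : {group gT}).

Lemma trivial_mx_repr : mx_repr G (fun _ : gT => 1%:M : 'M[F]_1).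
Proof. by split=> // g h _ _; rewrite mulmx1. Qed.

Definition trivial_repr : mx_representation F G 1 :=
  MxRepresentation trivial_mx_repr.

Fixpoint tensor_power d (rG : mx_representation F G d) (i : nat) :
    representation F G :=
  if i is j.+1 then Representation (prod_repr rG (tensor_power rG j))
  else Representation trivial_repr.

End TensorPower.

Section Chains.

Variables (n k : nat).

(* Only words of length at most k occur in ranks [1, k], so words are taken in
   the finite type k.-bseq 'I_n. *)
Definition word := k.-bseq 'I_n.

Definition strict_subword (u v : word) : bool := (u != v) && subseq u v.

(* The elements s_1 < ... < s_p of T, in increasing order. *)
Definition ranks (T : {set 'I_k.+1}) : seq nat := [seq val s | s <- enum T].

Definition is_max_chain (T : {set 'I_k.+1}) (c : seq word) : bool :=
  ([seq size w | w : word <- c] == ranks T) && sorted strict_subword c.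

Definition max_chain (T : {set 'I_k.+1}) : finType :=
  {c : #|T|.-tuple word | is_max_chain T c}.

(* Letterwise action; it is a right action because the product g * h of
   permutations applies g first. *)
Definition word_act (w : word) (g : 'S_n) : word := [bseq of map g w].

Lemma word_act_chain (T : {set 'I_k.+1}) (g : 'S_n) (c : seq word) :
  is_max_chain T c -> is_max_chain T [seq word_act w g | w <- c].
Proof.
case/andP=> /eqP szc sc; apply/andP; split.
  rewrite -szc -map_comp; apply/eqP/eq_map => w /=.
  by rewrite size_map.
rewrite sorted_map; apply: sub_sorted sc => u v /andP[neq sub].
apply/andP; split; last exact: map_subseq.
by apply: contra neq => /eqP/(congr1 val)/(inj_map (@perm_inj _ g))/val_inj ->.
Qed.

Definition chain_act (T : {set 'I_k.+1}) (c : max_chain T) (g : 'S_n) :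
    max_chain T :=
  exist (fun c : #|T|.-tuple word => is_max_chain T c)
    [tuple of [seq word_act w g | w <- val c]] (word_act_chain g (valP c)).

Lemma chain_act1 (T : {set 'I_k.+1}) : (@chain_act T)^~ 1%g =1 id.
Proof.
move=> c; do 2!apply: val_inj; rewrite /= -[RHS]map_id; apply: eq_map => w.
apply: val_inj; rewrite /= -[RHS]map_id; apply: eq_map => a.
exact: perm1.
Qed.

Lemma chain_actM (T : {set 'I_k.+1}) c : act_morph (@chain_act T) c.
Proof.
move=> g h; do 2!apply: val_inj; rewrite /= -map_comp; apply: eq_map => w.
apply: val_inj; rewrite /= -map_comp; apply: eq_map => a.
exact: permM.
Qed.

Definition chain_action (T : {set 'I_k.+1}) : {action 'S_n &-> max_chain T} :=
  TotalAction (@chain_act1 T) (@chain_actM T).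

End Chains.

(* A symmetric function is represented by the family, indexed by N, of the
   symmetric polynomials it induces in N variables. *)
Section SymmetricFunctions.

Variables (F : fieldType) (N : nat).

Definition power_sum (d : nat) : {mpoly F[N]} := \sum_(i < N) 'X_i ^+ d.

Definition complete_hom (d : nat) : {mpoly F[N]} :=
  \sum_(m : 'X_{1..N < d.+1} | mdeg m == d) 'X_[m].

(* The product h_1^r h_(n-r), for the partition (n - r, 1^r). *)
Definition h_hook (n r : nat) : {mpoly F[N]} :=
  complete_hom 1 ^+ r * complete_hom (n - r).

(* (1 / n!) sum_g chi(g) p_(cycle type of g) *)
Definition frobenius_ch n d (rG : mx_representation F [set: 'S_n] d) :
    {mpoly F[N]} :=
  (n`!%:R)^-1 *:
    \sum_(g : 'S_n) \tr (rG g) *: \prod_(X in porbits g) power_sum #|X|.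

End SymmetricFunctions.

(* Main.v *)
Require Import Defs.
From mathcomp Require Import ring.

(* A chain is fixed by g exactly when its largest word uses only letters fixed
   by g, so the character of the chain module at g is the number of maximal
   chains over an alphabet of x = #fix(g) letters. The number of words of length
   t containing a given word u depends only on |u| and is a polynomial in x - 1
   with nonnegative coefficients; hence so is the character, and x - 1 is the
   character of the reflection representation.
   If T is nonempty this polynomial is divisible by x, so it is a nonnegative
   combination of falling factorials x^_r with r >= 1, because
   m * m^_j = m^_(j+1) + j * m^_j. Finally x^_r is the character with
   characteristic h_1^r h_(n-r): summing over the point a fixed by g and
   identifying the stabiliser of a with S_(n-1) lowers both n and r, and for
   r = 0 the product of power sums of g is the sum of the monomials of the
   g-invariant colourings, so orbit counting gives n! h_n. *)

Set Implicit Arguments.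
Unset Strict Implicit.
Unset Printing Implicit Defensive.

Import GRing.Theory Num.Theory.
Local Open Scope ring_scope.

(** * Representations with equal characters are similar *)

Section TraceCriterion.

Variables (F : numClosedFieldType) (gT : finGroupType) (G : {group gT}).

Let charF'G : pgroup.pgroup [pchar F]^' G.
Proof.
rewrite /pgroup.pgroup (eq_pnat _ (eq_negn (@pchar_num F))).
exact: sub_in_pnat (pnat_pi (cardG_gt0 G)).
Qed.

Lemma mxtrace_gring_op n (rG : mx_representation F G n) (a : gT -> F) :
  \tr (gring_op rG (\sum_(x in G) a x *: regular_repr F G x)) =
    \sum_(x in G) a x * \tr (rG x).
Proof.
rewrite !linear_sum; apply: eq_bigr => x Gx.
by rewrite !linearZ /= gring_opG.
Qed.

Lemma eq_mxtrace_gring_op n1 n2 (rG1 : mx_representation F G n1)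
    (rG2 : mx_representation F G n2) A :
    (A \in group_ring F G)%MS ->
    {in G, forall x, \tr (rG1 x) = \tr (rG2 x)} ->
  \tr (gring_op rG1 A) = \tr (gring_op rG2 A).
Proof.
case/envelop_mxP=> a -> eq_tr; rewrite !mxtrace_gring_op.
by apply: eq_bigr => x Gx; rewrite eq_tr.
Qed.

Let iG : irrType F G := DecSocleType (regular_repr F G).

Lemma rsim_same_irr_comp n1 n2 (rG1 : mx_representation F G n1)
    (rG2 : mx_representation F G n2) :
    mx_irreducible rG1 -> mx_irreducible rG2 ->
  irr_comp iG rG1 = irr_comp iG rG2 -> mx_rsim rG1 rG2.
Proof.
move=> irr1 irr2 e12.
apply: mx_rsim_trans (rsim_irr_comp_pchar iG charF'G irr1) _.
by rewrite e12; apply/mx_rsim_sym/rsim_irr_comp_pchar.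
Qed.

Lemma mxtrace_gring_op_rsim n1 n2 (rG1 : mx_representation F G n1)
    (rG2 : mx_representation F G n2) A :
    (A \in group_ring F G)%MS -> mx_rsim rG1 rG2 ->
  \tr (gring_op rG1 A) = \tr (gring_op rG2 A).
Proof. by move=> GA /mxtrace_rsim; apply: eq_mxtrace_gring_op. Qed.

Lemma Wedderburn_id_group_ring i :
  (Wedderburn_id (sG := iG) i \in group_ring F G)%MS.
Proof.
apply: submx_trans (Wedderburn_id_mem i) _.
by rewrite -(Wedderburn_sum_pchar iG charF'G) (sumsmx_sup i).
Qed.

(** By Maschke [rG] is the sum of its socle components. The idempotent acts as the identity on
    constituents of type [i] and as zero on all others, so its trace is the dimension of the
    [i]-isotypic part. *)
Lemma trace_Wedderburn_id n (rG : mx_representation F G n) i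
    (sG := DecSocleType rG) :
  \tr (gring_op rG (Wedderburn_id (sG := iG) i)) =
    (\sum_(W : sG | irr_comp iG (socle_repr W) == i)
       socle_mult W * irr_degree i)%:R.
Proof.
have eG := Wedderburn_id_group_ring i.
have S1 : (Socle sG :=: 1%:M)%MS.
  by rewrite (reducible_Socle1 sG (mx_Maschke_pchar rG charF'G)).
rewrite -(mxtrace_gring_op_rsim eG (rsim_submod1 (Socle_module sG) S1)).
have trS : \tr (gring_op (submod_repr (Socle_module sG)) (Wedderburn_id i)) =
  \sum_(W : sG) \tr (gring_op (socle_repr W) (Wedderburn_id i)) *+ socle_mult W.
  case/envelop_mxP: eG => a ->; rewrite mxtrace_gring_op.
  under [RHS]eq_bigr do rewrite mxtrace_gring_op -sumrMnl.
  rewrite exchange_big; apply: eq_bigr => x Gx /=.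
  rewrite mxtrace_Socle // mulr_sumr.
  by apply: eq_bigr => W _; rewrite mulrnAr.
rewrite trS (bigID (fun W : sG => irr_comp iG (socle_repr W) == i)) /=.
rewrite [X in _ + X]big1 ?addr0 => [|W neW]; last first.
  rewrite (irr_comp'_op0_pchar charF'G (socle_irr W) _ (Wedderburn_id_mem i)).
    by rewrite linear0 mul0rn.
  by rewrite eq_sym.
rewrite natr_sum; apply: eq_bigr => W /eqP defi.
have sim := rsim_irr_comp_pchar iG charF'G (socle_irr W).
rewrite (mxtrace_gring_op_rsim eG sim) defi op_Wedderburn_id_pchar //.
by rewrite mxtrace1 -mulrnA mulnC.
Qed.

(* The Wedderburn idempotent of a constituent of rG1 has nonzero trace on rG1,
   hence on rG2; split off the common constituent on both sides. *)
Theorem mx_rsim_trace n1 n2 (rG1 : mx_representation F G n1)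
    (rG2 : mx_representation F G n2) :
  {in G, forall x, \tr (rG1 x) = \tr (rG2 x)} -> mx_rsim rG1 rG2.
Proof.
have [m] := ubnP n1.
elim: m n1 n2 rG1 rG2 => // m IHm n1 n2 rG1 rG2 /ltnSE le_n1m eq_tr.
(* The trace at the identity is the dimension, read off in characteristic zero. *)
have e12 : n1 = n2.
  apply/eqP; rewrite -(eqr_nat F); apply/eqP.
  by have := eq_tr 1%g (group1 G); rewrite !repr_mx1 !mxtrace1.
case: n2 / e12 in rG2 eq_tr *.
have [n1_0 | n1_gt0] := posnP n1.
  by exists 0 => [ | |x _]; rewrite ?mul0mx ?mulmx0 // /row_free mxrank0 n1_0.
pose sG1 := DecSocleType rG1; pose sG2 := DecSocleType rG2.
have S1 : Socle sG1 = 1%:M := reducible_Socle1 sG1 (mx_Maschke_pchar rG1 charF'G).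
have [W1 _ | noW] := pickP sG1; last first.
  move/(congr1 mxrank): S1; rewrite /Socle big_pred0 // mxrank0 mxrank1 => n10.
  by rewrite -n10 in n1_gt0.
pose i := irr_comp iG (socle_repr W1).
have rankW1 : (0 < \rank (socle_base W1))%N.
  by rewrite lt0n mxrank_eq0; case: (socle_simple W1).
have [W2 /eqP eqi] : exists W2 : sG2, irr_comp iG (socle_repr W2) == i.
  have := eq_mxtrace_gring_op (Wedderburn_id_group_ring i) eq_tr.
  rewrite !trace_Wedderburn_id => /eqP.
  rewrite eqr_nat => eq_sum; apply/existsP; apply: contraLR eq_sum => /existsPn no2.
  rewrite [X in _ != X]big_pred0 => [|W]; last exact/negbTE/no2.
  rewrite -lt0n (bigD1 W1) //= addn_gt0 muln_gt0 irr_degree_gt0 andbT.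
  by rewrite divn_gt0 // mxrankS // component_mx_id //; apply: socle_simple.
have simW12 := rsim_same_irr_comp (socle_irr W1) (socle_irr W2) (esym eqi).
have [V1 modV1 defV1 dxV1] :=
  mx_Maschke_pchar rG1 charF'G (socle_module W1) (submx1 _).
have [V2 modV2 defV2 dxV2] :=
  mx_Maschke_pchar rG2 charF'G (socle_module W2) (submx1 _).
(* The complements still have equal characters, and [V1] has smaller dimension because the simple
   module split off is nonzero. *)
have simV : mx_rsim (submod_repr modV1) (submod_repr modV2).
  apply: IHm => [|x Gx].
    apply: leq_trans le_n1m; rewrite -[ltnRHS](mxrank1 F) -defV1 (mxdirectP dxV1) /=.
    by rewrite -[ltnLHS]add0n ltn_add2r.
  have := eq_tr x Gx.
  rewrite -(mxtrace_submod1 (mxmodule1 rG1)) //.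
  rewrite -(mxtrace_submod1 (mxmodule1 rG2)) //.
  rewrite -(mxtrace_dadd_mod (socle_module W1) modV1 (mxmodule1 rG1) defV1 dxV1) //.
  rewrite -(mxtrace_dadd_mod (socle_module W2) modV2 (mxmodule1 rG2) defV2 dxV2) //.
  by rewrite (mxtrace_rsim simW12) // => /addrI.
apply: mx_rsim_trans (mx_rsim_sym (rsim_submod1 (mxmodule1 rG1) _)) _ => //.
apply: mx_rsim_trans (rsim_submod1 (mxmodule1 rG2) _) => //.
pose rU := Representation (socle_repr W2).
pose rV := Representation (submod_repr modV2).
apply: mx_rsim_trans
  (mx_rsim_dadd (rU := rU) (rV := rV) (mxmodule1 rG1) defV1 dxV1 simW12 simV) _.
apply/mx_rsim_sym.
exact: (mx_rsim_dadd (rU := rU) (rV := rV) (mxmodule1 rG2) defV2 dxV2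
  (mx_rsim_refl _) (mx_rsim_refl _)).
Qed.

End TraceCriterion.

(** * Characters of the modules involved *)

Lemma mxtrace_perm_repr (F : fieldType) (aT : finGroupType) (X : finType)
    (to : {action aT &-> X}) (g : aT) :
  \tr (perm_repr F to g) = #|[set x | to x g == x]|%:R.
Proof.
rewrite /mxtrace -sum1_card natr_sum [RHS]big_mkcond /=.
rewrite [RHS](reindex _ (onW_bij _ (enum_val_bij X))) /=.
by apply: eq_bigr => i _; rewrite mxE inE; case: eqP.
Qed.

Definition nfix n (g : 'S_n) : nat := #|[set i | g i == i]|.

Lemma mxtrace_refl_repr (F : numFieldType) n (g : 'S_n) : (0 < n)%N ->
  \tr (refl_repr F n g) = (nfix g)%:R - 1.
Proof.
move=> n_gt0; pose J : 'M[F]_(#|'I_n|, 1) := const_mx 1.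
(* P projects onto the sum-zero hyperplane, so the trace of g there is tr (g P). *)
pose P : 'M[F]_#|'I_n| := 1%:M - n%:R^-1 *: (J *m J^T).
have rJ : (natural_repr F n g) *m J = J.
  apply/matrixP=> i j; rewrite !mxE.
  rewrite (bigD1 (enum_rank (aperm (enum_val i) g))) //= !mxE enum_rankK eqxx.
  rewrite mul1r big1 ?addr0 // => l neq; rewrite !mxE mulr1.
  by case: eqP => // e; case/eqP: neq; rewrite e enum_valK.
have JJ : J^T *m J = n%:R%:M.
  apply/matrixP=> i j; rewrite !mxE !ord1 eqxx mulr1n.
  under eq_bigr do rewrite !mxE mulr1.
  by rewrite sumr_const !card_ord.
have PJ : P *m J = 0.
  rewrite mulmxBl mul1mx -scalemxAl -mulmxA JJ mul_mx_scalar scalerA.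
  by rewrite mulVf ?scale1r ?subrr // pnatr_eq0 -lt0n.
(* The rows of [B] are a basis of the hyperplane, and [P] factors as [D *m B] with [B *m D = 1%:M].
   Cyclicity of the trace then replaces [refl_repr] by [natural_repr] followed by [P]. *)
pose B := val_submod (U := sum_zero F n) 1%:M.
have BJ : B *m J = 0.
  by apply/sub_kermxP; rewrite val_submod1.
have BP : B *m P = B.
  by rewrite mulmxBr mulmx1 -scalemxAr mulmxA BJ mul0mx scaler0 subr0.
have /submxP[D PDB] : (P <= B)%MS by rewrite val_submod1; apply/sub_kermxP.
have BD : B *m D = 1%:M.
  apply: (@row_free_inj _ _ _ _ B); first by rewrite /row_free val_submod1.
  by rewrite -mulmxA -PDB BP mul1mx.
have MB : refl_repr F n g *m B = B *m natural_repr F n g.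
  by rewrite -val_submodE -[refl_repr F n g]mul1mx val_submodJ ?inE.
rewrite -[refl_repr F n g]mulmx1 -BD mulmxA MB mxtrace_mulC mulmxA -PDB mxtrace_mulC.
rewrite mulmxBr mulmx1 -scalemxAr [in X in _ *: X]mulmxA rJ.
rewrite linearB linearZ /= (mxtrace_mulC J) JJ.
rewrite mxtrace_scalar mulr1n mulVf ?pnatr_eq0 -?lt0n //; congr (_ - _).
exact: mxtrace_perm_repr.
Qed.

Lemma mxtrace_tensor_power (F : fieldType) (gT : finGroupType) (G : {group gT}) d
    (rG : mx_representation F G d) i g :
  \tr (tensor_power rG i g) = \tr (rG g) ^+ i.
Proof.
by elim: i => [|i IHi]; rewrite ?mxtrace1 // exprS -IHi -mxtrace_prod.
Qed.

Lemma mxtrace_dsum_grepr (F : fieldType) (gT : finGroupType) (G : {group gT})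
    (I : Type) (r : seq I) (rG : I -> representation F G) g :
  \tr ((\big[dadd_grepr/grepr0]_(i <- r) rG i) g) = \sum_(i <- r) \tr (rG i g).
Proof.
by apply: (big_morph (fun rho : representation F G => \tr (rho g))) => [rU rV|];
  rewrite ?mxtrace_block ?mxtrace1.
Qed.

Lemma mxtrace_muln_grepr (F : fieldType) (gT : finGroupType) (G : {group gT})
    (rG : representation F G) k g :
  \tr (muln_grepr rG k g) = \tr (rG g) *+ k.
Proof. by rewrite mxtrace_dsum_grepr sumr_const card_ord. Qed.

(** * Counting chains of words *)

Lemma big_tuple_cons (R : nmodType) (T : finType) t (f : seq T -> R) :
  \sum_(v : t.+1.-tuple T) f v = \sum_(x : T) \sum_(v : t.-tuple T) f (x :: v).
Proof.
rewrite pair_big /=.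
rewrite (reindex (fun p : T * t.-tuple T => cons_tuple p.1 p.2)) //=.
exists (fun v : t.+1.-tuple T => (thead v, [tuple of behead v])) => [[x v]|v] _ /=.
  by rewrite theadE; congr pair; apply: val_inj.
by rewrite [v in RHS]tuple_eta; apply: val_inj.
Qed.

Lemma sum_bseq_size (R : nmodType) (T : finType) k t (f : seq T -> R) : (t <= k)%N ->
  \sum_(w : k.-bseq T | size w == t) f w = \sum_(v : t.-tuple T) f v.
Proof.
move=> le_tk.
rewrite -(big_map (fun w : k.-bseq T => val w) (fun s => size s == t) f) /=.
rewrite -(big_map (fun v : t.-tuple T => val v) xpredT f) -[LHS]big_filter.
apply: perm_big; apply: uniq_perm => [||s].
- by rewrite filter_uniq // (map_inj_uniq val_inj) index_enum_uniq.
- by rewrite (map_inj_uniq val_inj) index_enum_uniq.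
rewrite mem_filter; apply/andP/mapP => [[szs _]|[v _ ->]].
  by exists (Tuple szs); rewrite ?mem_index_enum.
rewrite size_tuple eqxx; split=> //; apply/mapP.
by exists (widen_bseq le_tk (bseq_of_tuple v)); rewrite ?mem_index_enum.
Qed.

(* Counts the words of length t containing a given word of length s, over an
   alphabet of 'X + 1 letters, by their first letter: either it is the first
   letter of the given word, or it is one of 'X others. *)
Fixpoint superword_poly (s t : nat) : {poly nat} :=
  match s, t with
  | 0, _ => ('X + 1) ^+ t
  | s'.+1, 0 => 0
  | s'.+1, t'.+1 => superword_poly s' t' + 'X * superword_poly s t'
  end.

Lemma superword_poly0 t : superword_poly 0 t = ('X + 1) ^+ t.
Proof. by case: t. Qed.

(** A product suffices because the number of superwords of a word depends only on its length. *)
Fixpoint chain_poly (s : nat) (ss : seq nat) : {poly nat} :=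
  if ss is t :: ss' then superword_poly s t * chain_poly t ss' else 1.

(** Coefficients in [nat] make nonnegativity automatic, while the argument may be any ring element:
    for a permutation without fixed points it is -1. *)
Definition nat_horner (R : comNzRingType) (y : R) (p : {poly nat}) : R :=
  (map_poly (GRing.natmul 1 : nat -> R) p).[y].

Section NatHorner.

Variables (R : comNzRingType) (y : R).

Lemma nat_hornerD p q : nat_horner y (p + q) = nat_horner y p + nat_horner y q.
Proof. by rewrite /nat_horner rmorphD hornerD. Qed.

Lemma nat_hornerM p q : nat_horner y (p * q) = nat_horner y p * nat_horner y q.
Proof. by rewrite /nat_horner rmorphM hornerM. Qed.

Lemma nat_horner1 : nat_horner y 1 = 1.
Proof. by rewrite /nat_horner rmorph1 hornerC. Qed.

Lemma nat_horner0 : nat_horner y 0 = 0.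
Proof. by rewrite /nat_horner rmorph0 hornerC. Qed.

Lemma nat_hornerX : nat_horner y 'X = y.
Proof. by rewrite /nat_horner map_polyX hornerX. Qed.

Lemma nat_horner_XaddC_exp t : nat_horner y (('X + 1) ^+ t) = (y + 1) ^+ t.
Proof. by rewrite /nat_horner rmorphXn rmorphD rmorph1 /= map_polyX !hornerE. Qed.

Lemma nat_horner_coef p : nat_horner y p = \sum_(i < size p) y ^+ i *+ (p`_i)%R.
Proof.
rewrite /nat_horner (horner_coef_wide _ (size_poly _ _)).
by apply: eq_bigr => i _; rewrite coef_map mulr_natl.
Qed.

End NatHorner.

Section Counting.

Variables (R : comNzRingType) (T : finType) (A : {set T}).
Let y : R := #|A|%:R - 1.

Lemma sum_superwords t u : all (mem A) u ->
  \sum_(v : t.-tuple T) (all (mem A) v && subseq u v)%:R =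
    nat_horner y (superword_poly (size u) t).
Proof.
elim: t u => [|t IHt] u.
  rewrite (big_pred1 [tuple]) => [|v]; last by rewrite [v]tuple0 /= eqxx.
  by case: u => [_|a u _] /=; rewrite ?nat_horner1 ?nat_horner0.
have step x w : all (mem A) w ->
    \sum_(v : t.-tuple T) (all (mem A) (x :: v) && subseq w v)%:R =
      (x \in A)%:R * nat_horner y (superword_poly (size w) t).
  move=> Aw; rewrite -IHt // mulr_sumr; apply: eq_bigr => v _.
  by rewrite /= -andbA -natrM mulnb.
have cardA : \sum_x (x \in A)%:R = #|A|%:R :> R.
  rewrite -sum1_card natr_sum [RHS]big_mkcond; apply: eq_bigr => x _.
  exact: mulrb.
rewrite [LHS](big_tuple_cons _ (fun v => (all (mem A) v && subseq u v)%:R)).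
case: u => [_|a u Aau].
  (* The vacuous condition is restated as containment of the empty word in the tail, the form that
     [step] expects. *)
  under eq_bigr => x _ do under eq_bigr => v _ do rewrite sub0seq -(sub0seq v).
  under eq_bigr => x _ do rewrite step //.
  by rewrite -mulr_suml cardA !superword_poly0 !nat_horner_XaddC_exp exprS subrK.
have [Aa Au] : a \in A /\ all (mem A) u := andP Aau.
rewrite (bigD1 a) //= eqxx (step a u Au) Aa mul1r nat_hornerD; congr (_ + _).
(* A first letter other than [a] leaves all of [a :: u] to be found in the tail. There are [y] such
   letters, since [a] lies in [A]. *)
have cardA' : \sum_(x | x != a) (x \in A)%:R = y.
  by rewrite /y -cardA [in RHS](bigD1 a) //= Aa mulr1n addrAC subrr add0r.
rewrite nat_hornerM nat_hornerX -[X in X * _]cardA' mulr_suml.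
apply: eq_bigr => x /negbTE; rewrite eq_sym => neq_ax.
by rewrite -(step x (a :: u)) //=; under eq_bigr do rewrite neq_ax.
Qed.

End Counting.

(** * Chains fixed by a permutation *)

Section FixedChains.

Variables (n k : nat).

(** Once the first word [w] of the chain is chosen, the number of continuations depends only on its
    length, so the sum over [w] factors. *)
Lemma sum_word_chains (R : comNzRingType) (A : {set 'I_n}) ss (u : word n k) :
    all (mem A) u -> path ltn (size u) ss -> all (geq k) ss ->
  \sum_(c : (size ss).-tuple (word n k))
      ((map (fun w : word n k => size w) c == ss) &&
         path (@strict_subword n k) u c &&
         all (fun w : word n k => all (mem A) w) c)%:R =
    nat_horner (#|A|%:R - 1 : R) (chain_poly (size u) ss).
Proof.
elim: ss u => [|t ss IHss] u Au /=.
  rewrite (big_pred1 [tuple]) => [|v]; last by rewrite [v]tuple0 /= eqxx.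
  by rewrite /= nat_horner1.
case/andP=> lt_ut lt_tss /andP[le_tk le_ssk].
rewrite [LHS](big_tuple_cons _ (fun c : seq (word n k) =>
  ((map (fun w : word n k => size w) c == t :: ss) &&
     path (@strict_subword n k) u c &&
     all (fun w : word n k => all (mem A) w) c)%:R)).
rewrite nat_hornerM -(sum_superwords _ t Au).
rewrite -(sum_bseq_size (fun v => (all (mem A) v && subseq u v)%:R) le_tk).
rewrite mulr_suml [RHS]big_mkcond; apply: eq_bigr => w _.
case: eqP => [szw|/eqP/negbTE neq]; last first.
  by rewrite big1 // => c _; rewrite /= eqseq_cons neq.
have [Aw | nAw] := boolP (all (mem A) w); last first.
  by rewrite mul0r big1 // => c _; rewrite /= (negbTE nAw) andbF.
have neq_uw : u != w by apply: contraTneq lt_ut => ->; rewrite -szw ltnn.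
rewrite -szw -IHss ?szw // mulr_sumr; apply: eq_bigr => c _.
rewrite /= eqseq_cons szw eqxx Aw /strict_subword neq_uw /= -natrM mulnb.
by case: subseq; rewrite ?andbF.
Qed.

Lemma path_ltn_ranks (T : {set 'I_k.+1}) :
  (forall s : 'I_k.+1, s \in T -> (1 <= s)%N) -> path ltn 0 (ranks T).
Proof.
move=> T_gt0; have: sorted ltn (ranks T).
  apply: (subseq_sorted ltn_trans) (iota_ltn_sorted 0 k.+1).
  by rewrite -val_enum_ord map_subseq // enumT filter_subseq.
have: all (leq 1) (ranks T).
  by apply/allP=> ? /mapP[s]; rewrite mem_enum => /T_gt0 s_gt0 ->.
by case: (ranks T) => //= s ss /andP[-> _] ->.
Qed.

Lemma ranks_le (T : {set 'I_k.+1}) : all (geq k) (ranks T).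
Proof. by apply/allP=> ? /mapP[s _ ->]; rewrite /= -ltnS. Qed.

Lemma size_ranks (T : {set 'I_k.+1}) : size (ranks T) = #|T|.
Proof. by rewrite size_map cardE. Qed.

(** All ranks being positive, the empty word lies strictly below every chain and serves as a common
    starting point for the recursion. *)
Lemma is_max_chain_path (T : {set 'I_k.+1}) (c : seq (word n k)) :
    path ltn 0 (ranks T) ->
  is_max_chain T c =
    (map (fun w : word n k => size w) c == ranks T) &&
      path (@strict_subword n k) [bseq] c.
Proof.
move=> T_gt0; rewrite /is_max_chain; case: eqP => //= szc.
case: c szc => //= w c szc; rewrite -szc in T_gt0.
case/andP: T_gt0 => w_gt0 _; rewrite /strict_subword sub0seq andbT.
by case: eqP => // w0; rewrite -w0 in w_gt0.
Qed.

Lemma chain_act_fix (T : {set 'I_k.+1}) (c : max_chain n T) (g : 'S_n) :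
  (chain_act c g == c) =
    all (fun w : word n k => all (mem [set i | g i == i]) w) (val c).
Proof.
rewrite -val_eqE -val_eqE /=.
have fixE (X : eqType) (f : X -> X) s : (map f s == s) = all (fun x => f x == x) s.
  by elim: s => //= x s <-; rewrite eqseq_cons.
rewrite fixE; apply: eq_all => w; rewrite -val_eqE /= fixE.
by apply: eq_all => i; rewrite !inE.
Qed.

Lemma card_fixed_chains (R : comNzRingType) (T : {set 'I_k.+1}) (g : 'S_n) :
    (forall s : 'I_k.+1, s \in T -> (1 <= s)%N) ->
  #|[set c : max_chain n T | chain_action n T c g == c]|%:R =
    nat_horner ((nfix g)%:R - 1 : R) (chain_poly 0 (ranks T)).
Proof.
move=> /path_ltn_ranks T_gt0; pose A := [set i | g i == i].
have := @sum_word_chains R A (ranks T) [bseq] isT T_gt0 (ranks_le T).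
move=> <-; rewrite size_ranks.
have -> : #|[set c : max_chain n T | chain_action n T c g == c]| =
    #|[set c : #|T|.-tuple (word n k) | is_max_chain T c &&
        all (fun w : word n k => all (mem A) w) c]|.
  rewrite -(card_imset _ val_inj); congr #|pred_of_set _|.
  apply/setP=> c; rewrite inE; apply/imsetP/andP => [[d]|[Tc Ac]].
    by rewrite inE chain_act_fix => Ad ->; split=> //; apply: (valP d).
  by exists (exist (fun c : #|T|.-tuple (word n k) => is_max_chain T c) c Tc);
    rewrite // inE chain_act_fix.
rewrite -sum1_card natr_sum big_mkcond; apply: eq_bigr => c _.
by rewrite inE -mulrb (is_max_chain_path c T_gt0).
Qed.

End FixedChains.

(** * Expansion in falling factorials *)

Lemma poly_nat_ffact (p : {poly nat}) n :
  exists c : nat -> nat, forall m, (m < n)%N ->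
    p.[m] = (\sum_(j < n) c j * m ^_ j)%N.
Proof.
case: n => [|n]; first by exists (fun=> 0)%N.
elim/poly_ind: p => [|p a [c cP]].
  by exists (fun=> 0)%N => m _; rewrite horner0 big1.
(* Multiplying by [m] sends [m ^_ j] to [m ^_ j.+1 + j * m ^_ j], and [a] is the new constant term.
   The top term produced by the shift vanishes because [m] is at most [n]. *)
exists (fun j => (if j is i.+1 then c i else a) + j * c j)%N => m le_mn.
rewrite hornerMXaddC cP //.
under [RHS]eq_bigr do rewrite mulnDl.
rewrite big_split /= [in RHS]big_ord_recl /= ffactn0 muln1 -addnA addnC.
congr (_ + _)%N; rewrite [LHS]big_distrl /=.
have step j : (c j * m ^_ j * m = c j * m ^_ j.+1 + j * c j * m ^_ j)%N.
  rewrite ffactnSr.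
  (* The factor [m - j] is truncated subtraction; when it truncates, [m ^_ j] is already 0. *)
  have [le_jm | lt_mj] := leqP j m; last by rewrite ffact_small // !(muln0, mul0n).
  by rewrite -{2}(subnK le_jm); ring.
under eq_bigr do rewrite [(_ * _)%R]step.
rewrite big_split /=; congr (_ + _)%N.
by rewrite big_ord_recr /= ffact_small // muln0 addn0.
Qed.

Lemma nat_horner_natr (R : comNzRingType) (m : nat) p :
  nat_horner (m%:R : R) p = (p.[m])%:R.
Proof. by rewrite /nat_horner -(horner_map (GRing.natmul 1 : nat -> R)). Qed.

Lemma chain_poly_ffact (R : comNzRingType) n ss :
    path ltn 0 ss -> ss != [::] ->
  exists c : nat -> nat, forall x, (x <= n)%N ->
    nat_horner (x%:R - 1 : R) (chain_poly 0 ss) =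
      \sum_(1 <= r < n.+1) (x ^_ r)%:R *+ c r.
Proof.
case: ss => [|[|s] ss] //= _ _.
have [c cP] := poly_nat_ffact (('X + 1) ^+ s * chain_poly s.+1 ss) n.
(* Since the first rank is positive, a factor [x] splits off. The rest is expanded at [x - 1], and
   [x * (x - 1) ^_ j = x ^_ j.+1] shifts the index, so that [r] starts at 1. *)
exists (fun r => c r.-1) => x le_xn.
rewrite exprS -mulrA nat_hornerM -['X + 1]expr1 nat_horner_XaddC_exp expr1 subrK.
(* At [x = 0] the argument -1 is not a natural number, but the factor [x] kills both sides. *)
case: x le_xn => [_|m lt_mn].
  rewrite mul0r big_nat big1 // => r /andP[r_gt0 _].
  by rewrite ffact_small // mul0rn.
rewrite -natr1 addrK nat_horner_natr cP // big_add1 big_mkord natr_sum mulr_sumr.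
apply: eq_bigr => j _; rewrite /= ffactSS natr1 -natrM mulnCA mulnC.
by rewrite natrM mulr_natr.
Qed.

(** * Characteristics of falling factorials of the number of fixed points *)

Section InvariantColourings.

Variables (R : comNzRingType) (N : nat) (x : 'I_N -> R).

Definition invariant n (g : 'S_n) (f : {ffun 'I_n -> 'I_N}) :=
  [forall i, f (g i) == f i].

Lemma invariantP n (g : 'S_n) (f : {ffun 'I_n -> 'I_N}) :
  reflect (forall i, f (g i) = f i) (invariant g f).
Proof. exact: 'forall_eqP. Qed.

Definition colouring_sum n (g : 'S_n) :=
  \sum_(f : {ffun 'I_n -> 'I_N} | invariant g f) \prod_i x (f i).

Lemma invariant_porbit n (g : 'S_n) (f : {ffun 'I_n -> 'I_N}) i j :
  invariant g f -> j \in porbit g i -> f j = f i.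
Proof.
move/invariantP=> inv_f /porbitP[m ->].
by elim: m => [|m IHm]; rewrite ?expg0 ?perm1 // expgSr permM inv_f.
Qed.

(** Expanding the product of power sums chooses one colour per cycle of [g], which is the same as a
    colouring constant on cycles. *)
Lemma prod_porbits n (g : 'S_n) :
  \prod_(X in porbits g) \sum_j x j ^+ #|X| = colouring_sum g.
Proof.
have mem_cls i : porbit g i \in porbits g by apply: imset_f.
pose cls i : {X in porbits g} := exist (fun X => X \in porbits g) _ (mem_cls i).
rewrite big_sub bigA_distr_bigA /=.
have clsP (X : {X in porbits g}) : exists i, cls i == X.
  by case/imsetP: (valP X) => i _ defX; exists i; rewrite -val_eqE defX.
rewrite /colouring_sum.
rewrite (reindex (fun f : {ffun {X in porbits g} -> 'I_N} => [ffun i => f (cls i)])).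
  apply: eq_big => [f|f _].
    symmetry; apply/invariantP=> i; rewrite !ffunE; congr (f _); apply: val_inj.
    by have := porbit_perm g 1 i; rewrite expg1.
  rewrite [RHS](partition_big cls xpredT) //=; apply: eq_bigr => X _.
  transitivity (\prod_(i in val X) x (f X)); first by rewrite prodr_const.
  have defX i : (i \in val X) = (cls i == X).
    rewrite -val_eqE /=; case/imsetP: (valP X) => j _ ->.
    by rewrite eq_porbit_mem porbit_sym.
  by apply: eq_big => [i|i]; rewrite defX // => /eqP <-; rewrite ffunE.
(* The inverse reads the colour of a cycle at a chosen representative; invariance makes the choice
   harmless. *)
exists (fun f : {ffun 'I_n -> 'I_N} => [ffun X => f (xchoose (clsP X))])
    => [f _|f inv_f].
  by apply/ffunP=> X; rewrite !ffunE (eqP (xchooseP (clsP X))).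
apply/ffunP=> i; rewrite !ffunE; apply: (invariant_porbit inv_f).
by rewrite -eq_porbit_mem; have /eqP/(congr1 val)/= := xchooseP (clsP (cls i)) => ->.
Qed.

(** The lifted permutation has the extra fixed point [a], whose colour is free. *)
Lemma colouring_sum_lift n (a : 'I_n.+1) (h : 'S_n) :
  colouring_sum (lift_perm a a h) = (\sum_j x j) * colouring_sum h.
Proof.
rewrite /colouring_sum big_distrlr /= pair_big_dep /=.
pose ext (p : 'I_N * {ffun 'I_n -> 'I_N}) : {ffun 'I_n.+1 -> 'I_N} :=
  [ffun i => oapp p.2 p.1 (unlift a i)].
rewrite (reindex ext) /=; last first.
  exists (fun f => (f a, [ffun i => f (lift a i)])) => [[j f] _|f _].
    congr pair; first by rewrite ffunE unlift_none.
    by apply/ffunP=> i; rewrite !ffunE liftK.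
  apply/ffunP=> i; rewrite ffunE; case: unliftP => [i' ->|->] //=.
  by rewrite ffunE.
apply: eq_big => [[j f]|[j f] _] /=.
  apply/invariantP/invariantP=> inv_f i.
    by have := inv_f (lift a i); rewrite lift_perm_lift !ffunE !liftK.
  case: (unliftP a i) => [i' ->|->]; last by rewrite lift_perm_id.
  by rewrite lift_perm_lift !ffunE !liftK /= inv_f.
rewrite (bigD1_ord a) //= ffunE unlift_none; congr (_ * _).
by apply: eq_bigr => i _; rewrite ffunE liftK.
Qed.

Lemma nfix_lift n (a : 'I_n.+1) (h : 'S_n) :
  nfix (lift_perm a a h) = (nfix h).+1.
Proof.
rewrite /nfix -!sum1_card big_mkcond (bigD1_ord a) //= inE lift_perm_id eqxx.
rewrite add1n [in RHS]big_mkcond; congr _.+1; apply: eq_bigr => i _.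
by rewrite !inE lift_perm_lift (inj_eq (@lift_inj _ a)).
Qed.

Lemma sum_perm_fix (V : nmodType) n (a : 'I_n.+1) (F : 'S_n.+1 -> V) :
  \sum_(g : 'S_n.+1 | g a == a) F g = \sum_(h : 'S_n) F (lift_perm a a h).
Proof.
have inj_lift : injective (lift_perm a a).
  move=> g h eq_gh; apply/permP=> i; apply: (@lift_inj _ a).
  by rewrite -!(lift_perm_lift a) eq_gh.
rewrite -(big_imset F (h := lift_perm a a) (A := predT)) /=; last first.
  by move=> g h _ _; apply: inj_lift.
suff defS : lift_perm a a @: predT = [set g : 'S_n.+1 | g a == a].
  by apply: eq_bigl => g; rewrite defS inE.
(* Lifts fix [a]; equality follows by counting, as the stabiliser consists of the permutations
   supported off [a]. *)
apply/eqP; rewrite eqEcard; apply/andP; split.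
  by apply/subsetP=> _ /imsetP[h _ ->]; rewrite inE lift_perm_id.
have -> : [set g : 'S_n.+1 | g a == a] = [set g | perm_on [set~ a] g].
  apply/setP=> h; rewrite !inE; apply/eqP/subsetP=> [ha i|on_a].
    by rewrite !inE; apply: contraNneq => ->; rewrite ha.
  by apply/eqP; apply: contraT => /(on_a a); rewrite !inE eqxx.
rewrite card_imset // cardsE card_perm cardsC1 card_ord /= -card_Sn.
by apply: subset_leq_card; apply/subsetP=> ?.
Qed.

End InvariantColourings.

(** * Orbit counting for complete homogeneous polynomials *)

Lemma prod_mpolyX_s2m (F : comNzRingType) N (s : seq 'I_N) :
  \prod_(i <- s) 'X_i = 'X_[s2m s] :> {mpoly F[N]}.
Proof.
rewrite mprodXE; congr 'X_[_]; apply/mnmP=> i; rewrite mnmE mnm_sumE.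
rewrite -sum1_count [RHS]big_mkcond; apply: eq_bigr => j _.
by rewrite mnm1E /=; case: eqP.
Qed.

Lemma mdeg_s2m N (s : seq 'I_N) : mdeg (s2m s) = size s.
Proof.
elim: s => [|i s IHs]; first by rewrite mdegE big1 // => i _; rewrite mnmE.
suff -> : s2m (i :: s) = (U_(i) + s2m s)%MM by rewrite mdegD mdeg1 IHs.
by apply/mnmP=> j; rewrite mnmDE mnm1E !mnmE.
Qed.

Lemma s2m_perm_eq N (s t : seq 'I_N) : (s2m s == s2m t) = perm_eq s t.
Proof.
apply/eqP/idP => [eq_st|/seq.permP eq_st].
  by apply/allP=> i _; move/mnmP/(_ i): eq_st; rewrite !mnmE /= => ->.
by apply/mnmP=> i; rewrite !mnmE eq_st.
Qed.

Section CompleteHomogeneous.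

Variables (F : fieldType) (N : nat).

Local Notation csum g := (colouring_sum (fun i => 'X_i : {mpoly F[N]}) g).
Local Notation content f := (s2m (mktuple f)).

(* The colourings with a given content form one orbit of 'S_n. *)
Lemma card_stabilisers_content n (m : 'X_{1..N}) : mdeg m = n ->
  (\sum_(f : {ffun 'I_n -> 'I_N} | content f == m)
     #|[set g : 'S_n | invariant g f]|)%N = n`!.
Proof.
move=> deg_m; have szm : size (m2s m) == n by rewrite size_m2s deg_m.
pose f0 := tnth (Tuple szm).
have content_f0 : content f0 = m.
  have -> : mktuple f0 = Tuple szm by apply: eq_from_tnth => i; rewrite tnth_mktuple.
  exact: s2mK.
(* The stabiliser of [f] has as many elements as the set of permutations carrying [f0] to [f], a
   coset of it. Each [g] carries [f0] to exactly one [f], so the total is the order of the group. *)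
transitivity (\sum_(f : {ffun 'I_n -> 'I_N} | content f == m)
   \sum_(g : 'S_n | [forall i, f0 (g i) == f i]) 1)%N.
  apply: eq_bigr => f; rewrite -content_f0 s2m_perm_eq => /tuple_permP[h eq_fh].
  have {eq_fh} fE i : f i = f0 (h i).
    have := congr1 (fun t => nth (f i) t i) eq_fh.
    by rewrite -!tnth_nth !tnth_mktuple.
  rewrite (reindex_inj (mulIg h)) /= -sum1_card; apply: eq_bigl => g.
  by rewrite inE; apply: eq_forallb => i; rewrite permM -fE.
rewrite (exchange_big_dep xpredT) //= -card_Sn -sum1_card.
apply: eq_big => [g|g _]; first by rewrite inE.
rewrite (big_pred1 [ffun i => f0 (g i)]) // => f.
apply/andP/eqP => [[_ /forallP fE]|->].
  by apply/ffunP=> i; rewrite ffunE (eqP (fE i)).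
split; last by apply/forallP=> i; rewrite ffunE.
rewrite -content_f0 s2m_perm_eq; apply/tuple_permP; exists g.
by apply: eq_map => i; rewrite tnth_mktuple ffunE.
Qed.

(** After exchanging the sums, each colouring contributes its monomial once per stabilising
    permutation; grouping by content collects every monomial of degree [n] exactly [n!] times. *)
Lemma sum_csum n : \sum_(g : 'S_n) csum g = complete_hom F N n *+ n`!.
Proof.
rewrite /colouring_sum (exchange_big_dep xpredT) //=.
have deg_content (f : {ffun 'I_n -> 'I_N}) : mdeg (content f) = n.
  by rewrite mdeg_s2m size_tuple.
have bounded (f : {ffun 'I_n -> 'I_N}) : (mdeg (content f) < n.+1)%N.
  by rewrite deg_content.
rewrite (partition_big (fun f => BMultinom (bounded f)) (fun m => mdeg m == n)) /=;
  last by move=> f _; rewrite deg_content.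
rewrite /complete_hom -sumrMnl; apply: eq_bigr => m /eqP deg_m.
rewrite -(card_stabilisers_content deg_m) -sumrMnr.
apply: eq_big => [f|f /eqP <-]; first by rewrite -val_eqE.
rewrite sumr_const cardsE; congr (_ *+ _).
by rewrite -prod_mpolyX_s2m /= big_map enumT.
Qed.

(** With [x] fixed points, [x ^_ r.+1] is [x * (x - 1) ^_ r], and the factor [x] is the choice of a
    fixed point [a]. Deleting [a] leaves a permutation of [n] points; the [n.+1] choices of [a]
    contribute equally. *)
Lemma sum_ffact_csum_rec n r :
  \sum_(g : 'S_n.+1) csum g *+ nfix g ^_ r.+1 =
    (power_sum F N 1 * \sum_(g : 'S_n) csum g *+ nfix g ^_ r) *+ n.+1.
Proof.
transitivity
  (\sum_(a < n.+1) \sum_(g : 'S_n.+1 | g a == a) csum g *+ (nfix g).-1 ^_ r).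
  rewrite (exchange_big_dep xpredT) //=; apply: eq_bigr => g _.
  rewrite sumr_const ffactnS mulnC mulrnA; congr (_ *+ _).
  by apply: eq_card => a; rewrite !inE.
rewrite -[n.+1 in RHS]card_ord -sumr_const; apply: eq_bigr => a _.
rewrite sum_perm_fix mulr_sumr; apply: eq_bigr => h _.
by rewrite nfix_lift colouring_sum_lift mulrnAr.
Qed.

Lemma complete_hom0 : complete_hom F N 0 = 1.
Proof.
rewrite /complete_hom (big_pred1 (@bm0 N 0)) ?mpolyX0 //.
by move=> m; rewrite mdeg_eq0.
Qed.

(** Orbit counting for ['S_1], whose only point is fixed and can be deleted. *)
Lemma complete_hom1 : complete_hom F N 1 = power_sum F N 1.
Proof.
have -> : complete_hom F N 1 = \sum_(g : 'S_1) csum g by rewrite sum_csum.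
rewrite (eq_bigl (fun g : 'S_1 => g ord0 == ord0)) => [|g]; last first.
  by rewrite ord1 eqxx.
rewrite sum_perm_fix; under eq_bigr do rewrite colouring_sum_lift.
by rewrite -mulr_sumr sum_csum complete_hom0 mulr1n mulr1.
Qed.

Lemma sum_ffact_csum n r : (r <= n)%N ->
  \sum_(g : 'S_n) csum g *+ nfix g ^_ r = h_hook F N n r *+ n`!.
Proof.
rewrite /h_hook complete_hom1; elim: r n => [|r IHr] [|n] // le_rn.
- by rewrite mul1r -sum_csum.
- by rewrite mul1r -sum_csum.
rewrite sum_ffact_csum_rec IHr // mulrnAr -mulrnA mulrA exprS subSS.
by rewrite factS mulnC.
Qed.

End CompleteHomogeneous.

Theorem theorem1 (R : realType) (n k : nat) (hn : (2 <= n)%N) (hk : (1 <= k)%N)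
    (T : {set 'I_k.+1}) (hT : forall s : 'I_k.+1, s \in T -> (1 <= s)%N) :
  (exists (d : nat) (m : nat -> nat),
     mx_rsim (perm_repr R[i] (chain_action n T))
       (\big[dadd_grepr/grepr0]_(i < d)
          muln_grepr (tensor_power (refl_repr R[i] n) i) (m i)))
  /\
  ((1 <= #|T|)%N ->
   exists c : nat -> nat, forall N : nat,
     frobenius_ch N (perm_repr R[i] (chain_action n T)) =
       \sum_(1 <= r < n.+1) h_hook R[i] N n r *+ c r).
Proof.
have n_gt0 : (0 < n)%N by exact: ltnW.
have chi g : \tr (perm_repr R[i] (chain_action n T) g) =
    nat_horner ((nfix g)%:R - 1) (chain_poly 0 (ranks T)).
  by rewrite mxtrace_perm_repr card_fixed_chains.
split.
  (* The multiplicities are the coefficients of the character as a polynomial in the reflection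
     character. For empty [T] this polynomial is 1, giving the trivial module. *)
  pose p := chain_poly 0 (ranks T); exists (size p), (fun i => p`_i)%R.
  apply: mx_rsim_trace => g _; rewrite chi nat_horner_coef.
  rewrite mxtrace_dsum_grepr; apply: eq_bigr => i _.
  by rewrite mxtrace_muln_grepr mxtrace_tensor_power mxtrace_refl_repr.
move=> T_neq0; have nz_ranks : ranks T != [::] by rewrite -size_eq0 size_ranks -lt0n.
(* The coefficients come from the character alone, hence are the same for every number [N] of
   variables. *)
have [c cP] := chain_poly_ffact R[i] n (path_ltn_ranks hT) nz_ranks.
exists c => N; rewrite /frobenius_ch.
have nfix_le (g : 'S_n) : (nfix g <= n)%N.
  by rewrite -[X in (_ <= X)%N](card_ord n) max_card.
under eq_bigr => g _.
  rewrite chi (cP _ (nfix_le g)) (prod_porbits (fun i => 'X_i : {mpoly R[i][N]})).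
  rewrite scaler_suml.
  over.
rewrite exchange_big scaler_sumr; apply: eq_big_nat => r /andP[_ le_rn] /=.
transitivity ((n`!%:R)^-1 *: (h_hook R[i] N n r *+ n`! *+ c r)).
  rewrite -(sum_ffact_csum _ _ (ltnSE le_rn)) -sumrMnl; congr (_ *: _).
  by apply: eq_bigr => g _; rewrite -scalerMnl scaler_nat.
rewrite -!scalerMnr scalerMnl -mulr_natr mulVf ?scale1r //.
by rewrite pnatr_eq0 -lt0n fact_gt0.
Qed.
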